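(* Let $X$ be a Banach space and let $T\in L(X)$. Then the following statements hold. (i) $\sigma_{desc}(T)\subseteq\sigma_{desc}(L_T)$ and $\sigma_{asc}(T)=\sigma_{asc}(L_T)$. (ii) $\sigma_{\mathcal{RD}}(T)\subseteq\sigma_{\mathcal{RD}}(L_T)$ and $\sigma_{\mathcal{LD}}(T)\subseteq\sigma_{\mathcal{LD}}(L_T)$. (iii) $\sigma_{asc}(T)\subseteq\sigma_{desc}(R_T)$ and $\sigma_{asc}(R_T)\subseteq\sigma_{desc}(T)$. Furthermore, (iv) $\sigma_{desc}(L_T)\setminus\sigma_{desc}(T)\subseteq\sigma_{asc}(T)$ and $\sigma_{desc}(L_T)\cap\rho_{asc}(T)=\sigma_{desc}(T)\cap\rho_{asc}(T)$. (v) $\sigma_{\mathcal{RD}}(L_T)\setminus\sigma_{\mathcal{RD}}(T)\subseteq\sigma_{\mathcal{LD}}(T)$ and $\sigma_{\mathcal{RD}}(L_T)\cap\rho_{\mathcal{LD}}(T)=\sigma_{\mathcal{RD}}(T)\cap\rho_{\mathcal{LD}}(T)$. (vi) $\sigma_{\mathcal{LD}}(L_T)\setminus\sigma_{\mathcal{LD}}(T)\subseteq\sigma_{\mathcal{RD}}(T)$ and $\sigma_{\mathcal{LD}}(L_T)\cap\rho_{\mathcal{RD}}(T)=\sigma_{\mathcal{LD}}(T)\cap\rho_{\mathcal{RD}}(T)$. (vii) $\sigma_{desc}(R_T)\setminus\sigma_{asc}(T)\subseteq\sigma_{desc}(T)$ and $\sigma_{desc}(R_T)\cap\rho_{desc}(T)=\sigma_{asc}(T)\cap\rho_{desc}(T)$.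 (viii) $\sigma_{desc}(T)\setminus\sigma_{asc}(R_T)\subseteq\sigma_{desc}(R_T)$ and $\sigma_{desc}(T)\cap\rho_{desc}(R_T)=\sigma_{asc}(R_T)\cap\rho_{desc}(R_T)$.
   Context: Banach spaces are complex. For a Banach space $Y$, $L(Y)$ is the Banach algebra of all bounded linear operators on $Y$; $N(S)$ and $R(S)$ are the null space and range of $S\in L(Y)$. For $T\in L(X)$, the operators $L_T,R_T\in L(L(X))$ are the left and right multiplication operators $L_T(U)=TU$ and $R_T(U)=UT$ for $U\in L(X)$. For a Banach space $Y$ and $S\in L(Y)$, the descent is $d(S)=\inf\{n\ge 0: R(S^n)=R(S^{n+1})\}$ and the ascent is $a(S)=\inf\{n\ge 0: N(S^n)=N(S^{n+1})\}$, with $\inf\emptyset=\infty$. The operator $S$ is left Drazin invertible if $a(S)$ is finite and $R(S^{a(S)+1})$ is closed, and right Drazin invertible if $d(S)$ is finite and $R(S^{d(S)})$ is closed. Define $\sigma_{desc}(S)=\{\lambda\in\mathbb{C}: d(S-\lambda)=\infty\}$, $\sigma_{asc}(S)=\{\lambda\in\mathbb{C}: a(S-\lambda)=\infty\}$, $\sigma_{\mathcal{LD}}(S)=\{\lambda\in\mathbb{C}: S-\lambda\text{ is not left Drazin invertible}\}$, $\sigma_{\mathcal{RD}}(S)=\{\lambda\in\mathbb{C}: S-\lambda\text{ is not right Drazin invertible}\}$. The sets $\rho_{desc}(S),\rho_{asc}(S),\rho_{\mathcal{LD}}(S),\rho_{\mathcal{RD}}(S)$ are the complements in $\mathbb{C}$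 of $\sigma_{desc}(S),\sigma_{asc}(S),\sigma_{\mathcal{LD}}(S),\sigma_{\mathcal{RD}}(S)$ respectively. *)

(* Defs.v *)
From HB Require Import structures.
From mathcomp Require Import all_boot all_order all_algebra.
From mathcomp Require Import complex.
From mathcomp Require Import all_classical all_reals all_analysis.

Set Implicit Arguments.
Unset Strict Implicit.
Unset Printing Implicit Defensive.

Import Order.TTheory GRing.Theory Num.Theory.
Import numFieldNormedType.Exports.

Local Open Scope classical_set_scope.
Local Open Scope complex_scope.
Local Open Scope ring_scope.

Section BoundedOperators.
Context {R : realType}.
Local Notation C := R[i].

Definition is_bounded_op (X : normedModType C) : {pred X -> X} :=
  fun f => `[< linear f /\ exists M : C, forall x, `|f x| <= M * `|x| >].

(* L(X), a Banach algebra for composition and the operator norm. *)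
Record blinop (X : normedModType C) := Blinop {
  blinop_fun :> X -> X;
  blinop_funP : blinop_fun \in @is_bounded_op X }.

HB.instance Definition _ (X : normedModType C) :=
  [isSub of blinop X for @blinop_fun X].
HB.instance Definition _ (X : normedModType C) := [Choice of blinop X by <:].

Section Theory.
Variable X : normedModType C.
Implicit Types (S U V : blinop X) (f g : X -> X).

Lemma is_bounded_opP f :
  reflect (linear f /\ exists M : C, forall x, `|f x| <= M * `|x|)
          (f \in @is_bounded_op X).
Proof. exact: asboolP. Qed.

Fact is_bounded_op_closed : subsemimod_closed (@is_bounded_op X).
Proof.
split; first split.
- apply/is_bounded_opP; split.
    by move=> a x y; rewrite /GRing.zero/= scaler0 addr0.
  by exists 0 => x; rewrite normr0 mul0r.
- move=> f g /is_bounded_opP[lf [M fM]] /is_bounded_opP[lg [N gN]].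
  apply/is_bounded_opP; split.
    by move=> a x y; rewrite /GRing.add/= lf lg scalerDr addrACA.
  exists (M + N) => x; rewrite mulrDl.
  exact: le_trans (ler_normD _ _) (lerD (fM x) (gN x)).
- move=> a f /is_bounded_opP[lf [M fM]].
  have aE x : (a *: f) x = a *: f x by [].
  apply/is_bounded_opP; split.
    by move=> b x y; rewrite !aE lf scalerDr !scalerA [a * b]mulrC.
  by exists (`|a| * M) => x; rewrite aE normrZ -mulrA ler_wpM2l.
Qed.

HB.instance Definition _ :=
  GRing.SubChoice_isSubLmodule.Build C (X -> X) (@is_bounded_op X) (blinop X)
    is_bounded_op_closed.

Lemma blinopP U V : (forall x, U x = V x) <-> U = V.
Proof. by split=> [UV|->//]; apply/val_inj/funext. Qed.

Lemma blinop_linear U : linear U.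
Proof. by have /is_bounded_opP[] := blinop_funP U. Qed.

HB.instance Definition _ U :=
  GRing.isLinear.Build C X X *:%R (blinop_fun U) (blinop_linear U).

Lemma blinop0E x : (0 : blinop X) x = 0. Proof. by []. Qed.
Lemma blinopDE U V x : (U + V) x = U x + V x. Proof. by []. Qed.
Lemma blinopNE U x : (- U) x = - U x. Proof. by []. Qed.
Lemma blinopZE a U x : (a *: U) x = a *: U x. Proof. by []. Qed.

Lemma ge0_ReE (z : C) : 0 <= z -> z = (complex.Re z)%:C.
Proof. by rewrite lecE/=; case: z => a b /= /andP[/eqP -> _]. Qed.

Lemma normRe (x : X) : `|x| = (complex.Re `|x|)%:C.
Proof. exact: ge0_ReE. Qed.

Lemma blinop_bound U : exists2 M : R, 0 <= M & forall x, `|U x| <= M%:C * `|x|.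
Proof.
have /is_bounded_opP[_ [M UM]] := blinop_funP U.
have hM : `|M| = (complex.Re `|M|)%:C.
  by apply: ge0_ReE; exact: normr_ge0.
exists (complex.Re `|M|).
  by rewrite -lecR -hM; exact: normr_ge0.
move=> x; rewrite -hM.
have MV := le_trans (normr_ge0 (U x)) (UM x).
by rewrite (le_trans (UM x))// -(ger0_norm MV) normrM normr_id.
Qed.

Fact blinop_id_subproof : idfun \in @is_bounded_op X.
Proof.
by apply/is_bounded_opP; split=> //; exists 1 => x; rewrite mul1r.
Qed.

Fact blinop_comp_subproof U V : U \o V \in @is_bounded_op X.
Proof.
have [[M M0 UM] [N N0 VN]] := (blinop_bound U, blinop_bound V).
apply/is_bounded_opP; split; first by move=> a x y /=; rewrite !linearP.
exists (M%:C * N%:C) => x /=; rewrite (le_trans (UM _))// -mulrA.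
by rewrite ler_wpM2l// -[0]/(0%:C) lecR.
Qed.

Definition blinop_id := Blinop blinop_id_subproof.
Definition blinop_comp U V := Blinop (blinop_comp_subproof U V).

Fact blinop_compA : associative blinop_comp.
Proof. by move=> U V W; apply/blinopP. Qed.
Fact blinop_comp1l : left_id blinop_id blinop_comp.
Proof. by move=> U; apply/blinopP. Qed.
Fact blinop_comp1r : right_id blinop_id blinop_comp.
Proof. by move=> U; apply/blinopP. Qed.
Fact blinop_compDl : left_distributive blinop_comp +%R.
Proof. by move=> U V W; apply/blinopP. Qed.
Fact blinop_compDr : right_distributive blinop_comp +%R.
Proof. by move=> U V W; apply/blinopP => x /=; exact: raddfD. Qed.

(* Only a [pzRingType]: 1 = 0 when X is the zero space. *)
HB.instance Definition _ := GRing.Zmodule_isPzRing.Build (blinop X)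
  blinop_compA blinop_comp1l blinop_comp1r blinop_compDl blinop_compDr.

Lemma blinop1E x : (1 : blinop X) x = x. Proof. by []. Qed.
Lemma blinopME U V x : (U * V) x = U (V x). Proof. by []. Qed.

(* Norms of vectors are nonnegative elements of R[i]; the supremum is taken
   over their real parts. *)
Definition opnorm U : C :=
  (sup [set complex.Re `|U x| | x in [set x : X | `|x| <= 1]])%:C.

Lemma opnorm_has_sup U :
  has_sup [set complex.Re `|U x| | x in [set x : X | `|x| <= 1]].
Proof.
split; first by exists (complex.Re `|U 0|), 0 => //=; rewrite normr0.
have [M M0 UM] := blinop_bound U.
exists M => _ [x /= x1 <-]; rewrite -lecR -normRe (le_trans (UM x))//.
by rewrite -[leRHS]mulr1 ler_wpM2l// -[0]/(0%:C) lecR.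
Qed.

Lemma opnorm_ge0 U : 0 <= opnorm U.
Proof.
rewrite /opnorm -[0]/(0%:C) lecR.
apply: (@ub_le_sup _ [set complex.Re `|U x| | x in [set x : X | `|x| <= 1]]).
  exact: (opnorm_has_sup U).2.
by exists 0 => /=; rewrite ?normr0// raddf0 normr0.
Qed.

Lemma ler_opnorm U x : `|U x| <= opnorm U * `|x|.
Proof.
have [->|x0] := eqVneq x 0; first by rewrite raddf0 !normr0 mulr0.
rewrite -ler_pdivrMr ?normr_gt0// mulrC.
have -> : `|x|^-1 * `|U x| = `|U (`|x|^-1 *: x)|.
  by rewrite linearZ/= normrZ normfV normr_id.
rewrite normRe /opnorm lecR; apply: ub_le_sup.
  exact: (opnorm_has_sup U).2.
by exists (`|x|^-1 *: x) => //=; rewrite normfZV.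
Qed.

Lemma opnorm_le U (M : C) : 0 <= M -> (forall x, `|U x| <= M * `|x|) ->
  opnorm U <= M.
Proof.
move=> M0 UM; have hM := ge0_ReE M0.
rewrite hM /opnorm lecR; apply: ge_sup; first exact: (opnorm_has_sup U).1.
move=> _ [x /= x1 <-]; rewrite -lecR -normRe -hM (le_trans (UM x))//.
by rewrite -[leRHS]mulr1 ler_wpM2l.
Qed.

Fact opnormD U V : opnorm (U + V) <= opnorm U + opnorm V.
Proof.
apply: opnorm_le; first by rewrite addr_ge0 ?opnorm_ge0.
move=> x; rewrite blinopDE mulrDl.
exact: le_trans (ler_normD _ _) (lerD (ler_opnorm U x) (ler_opnorm V x)).
Qed.

Fact opnormZ (a : C) U : opnorm (a *: U) = `|a| * opnorm U.
Proof.
apply/le_anti/andP; split.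
  apply: opnorm_le; first by rewrite mulr_ge0 ?opnorm_ge0.
  by move=> x; rewrite blinopZE normrZ -mulrA ler_wpM2l ?ler_opnorm.
have [->|a0] := eqVneq a 0; first by rewrite normr0 mul0r opnorm_ge0.
rewrite -ler_pdivlMl ?normr_gt0//; apply: opnorm_le.
  by rewrite mulr_ge0 ?opnorm_ge0// invr_ge0.
move=> x; rewrite -mulrA ler_pdivlMl ?normr_gt0// -normrZ -blinopZE.
exact: ler_opnorm.
Qed.

Fact opnorm0_eq0 U : opnorm U = 0 -> U = 0.
Proof.
move=> U0; apply/blinopP => x; apply/eqP; rewrite -normr_le0.
by rewrite (le_trans (ler_opnorm U x))// U0 mul0r.
Qed.

HB.instance Definition _ :=
  Lmodule_isNormed.Build C (blinop X) opnormD opnormZ opnorm0_eq0.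

Lemma blinop_normE U : `|U| = opnorm U. Proof. by []. Qed.

End Theory.

Section Completeness.
Variable X : completeNormedModType C.

Fact blinop_complete (F : set_system (blinop X)) :
  ProperFilter F -> cauchy F -> cvg F.
Proof.
move=> FF Fc.
have FB (e : C) : 0 < e -> exists2 A : set (blinop X), F A &
    forall U V, A U -> A V -> forall x, `|U x - V x| <= e * `|x|.
  move=> e0; have /cauchy_ballP/(_ e e0) := Fc.
  move=> [[A B] /= [FA FB] AB]; exists (A `&` B); first exact: filterI.
  move=> U V [AU _] [_ BV] x; have /= := AB (U, V) (conj AU BV).
  rewrite -ball_normE/= => /ltW UVe.
  by rewrite -blinopNE -blinopDE (le_trans (ler_opnorm (U - V) x))// ler_wpM2r.
have Xc x : cvg ((fun U : blinop X => U x) @ F).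
  apply: cauchy_cvg; apply/cauchy_ballP => e e0.
  have d0 : 0 < e / (`|x| + 1) by rewrite divr_gt0// ltr_wpDl.
  have [A FA AP] := FB _ d0.
  exists ([set U x | U in A], [set U x | U in A]) => /=.
    by split; apply: (@filterS _ F _ A) => // U AU; exists U.
  move=> [_ _] /= [[U AU <-] [V AV <-]]; rewrite -ball_normE/=.
  rewrite (le_lt_trans (AP U V AU AV x))// mulrAC ltr_pdivrMr ?ltr_wpDl//.
  by rewrite ltr_pM2l// ltrDl.
pose g x : X := lim ((fun U : blinop X => U x) @ F).
have Ug (e : C) : 0 < e -> exists2 A : set (blinop X), F A &
    forall U, A U -> forall x, `|U x - g x| <= e * `|x|.
  move=> e0; have [A FA AP] := FB e e0; exists A => // U AU x.
  apply/ler_addgt0Pr => d d0.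
  have /cvgrPdist_lt/(_ d d0) := Xc x => Fd.
  have [V [AV Vd]] := filter_ex (filterI FA Fd).
  rewrite -(subrKA (V x)) (le_trans (ler_normD _ _))// lerD ?AP//.
  by rewrite distrC ltW.
have gP : g \in @is_bounded_op X.
  apply/is_bounded_opP; split.
    move=> a x y; apply: cvg_lim => //=.
    under eq_fun do rewrite linearP.
    exact: cvgD (cvgZl_tmp (Xc x)) (Xc y).
  have [A FA AP] := Ug 1 ltr01; have [U AU] := filter_ex FA.
  exists (`|U| + 1) => x; rewrite -[g x](subKr (U x)) mulrDl.
  by rewrite (le_trans (ler_normB _ _))// lerD ?ler_opnorm// AP.
apply/cvg_ex; exists (Blinop gP); apply/cvgrPdist_le => e e0.
have [A FA AP] := Ug e e0; apply: filterS FA => U AU.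
by rewrite distrC; apply: opnorm_le; [exact: ltW|exact: AP].
Qed.

HB.instance Definition _ :=
  Uniform_isComplete.Build (blinop X) blinop_complete.

End Completeness.

Section Multiplications.
Variable X : completeNormedModType C.
Implicit Types T U : blinop X.

Lemma blinop_normM T U : `|T * U| <= `|T| * `|U|.
Proof.
apply: opnorm_le => [|x]; first by rewrite mulr_ge0.
apply: le_trans (ler_opnorm T (U x)) _; rewrite -mulrA.
by apply: ler_wpM2l; [exact: opnorm_ge0|exact: ler_opnorm].
Qed.

Fact lmulop_subproof T : (fun U => T * U) \in @is_bounded_op (blinop X).
Proof.
apply/is_bounded_opP; split; last by exists `|T| => U; exact: blinop_normM.
by move=> a U V; apply/blinopP => x; exact: linearP.
Qed.

Fact rmulop_subproof T : (fun U => U * T) \in @is_bounded_op (blinop X).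
Proof.
apply/is_bounded_opP; split; first by move=> a U V; apply/blinopP.
by exists `|T| => U; rewrite mulrC; exact: blinop_normM.
Qed.

Definition lmulop T : blinop (blinop X) := Blinop (lmulop_subproof T).
Definition rmulop T : blinop (blinop X) := Blinop (rmulop_subproof T).

End Multiplications.

(* Infimum of a set of naturals, [None] standing for inf set0 = infinity. *)
Definition nat_inf (A : set nat) : option nat :=
  if pselect (exists n, n \in A) is left A0 then Some (ex_minn A0) else None.

Section Spectra.
Variable Y : completeNormedModType C.
Implicit Types (S : blinop Y) (l : C).

Definition null_space S : set Y := [set y | S y = 0].

Definition descent S : option nat :=
  nat_inf [set n | range (S ^+ n) = range (S ^+ n.+1)].

Definition ascent S : option nat :=
  nat_inf [set n | null_space (S ^+ n) = null_space (S ^+ n.+1)].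

Definition left_drazin_invertible S : Prop :=
  exists2 n, ascent S = Some n & closed (range (S ^+ n.+1)).

Definition right_drazin_invertible S : Prop :=
  exists2 n, descent S = Some n & closed (range (S ^+ n)).

Definition sigma_desc S : set C := [set l | descent (S - l *: (1 : blinop Y)) = None].
Definition sigma_asc S : set C := [set l | ascent (S - l *: (1 : blinop Y)) = None].
Definition sigma_LD S : set C :=
  [set l | ~ left_drazin_invertible (S - l *: (1 : blinop Y))].
Definition sigma_RD S : set C :=
  [set l | ~ right_drazin_invertible (S - l *: (1 : blinop Y))].

Definition rho_desc S : set C := ~` sigma_desc S.
Definition rho_asc S : set C := ~` sigma_asc S.
Definition rho_LD S : set C := ~` sigma_LD S.
Definition rho_RD S : set C := ~` sigma_RD S.

End Spectra.
End BoundedOperators.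

(* Main.v *)
From HB Require Import structures.
Require Import Defs.
From mathcomp Require Import all_boot all_order all_algebra.
From mathcomp Require Import lra complex.
From mathcomp Require Import all_classical all_reals all_analysis.

Set Implicit Arguments.
Unset Strict Implicit.
Unset Printing Implicit Defensive.

Import Order.TTheory GRing.Theory Num.Theory.
Import numFieldNormedType.Exports.

Local Open Scope classical_set_scope.
Local Open Scope ring_scope.

(** Since [L_T - l = L_(T - l)], and likewise on the right, everything reduces
    to a single operator [S], its powers, and [L_(S^n) = (L_S)^n],
    [R_(S^n) = (R_S)^n].

    From the multiplications to [S].  Equality of the ranges of two consecutive
    powers of [L_S] or [R_S], tested on the identity, reads [S^n = S^(n+1) U]
    or [S^n = U S^(n+1)]; the first gives [S] finite descent, the second gives
    it finite ascent.  Dually, an operator that kills [R(S^(n+1))] kills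
    [R(S^n)] as soon as these ranges agree, so finite descent of [S] gives
    finite ascent of [R_S].  For null spaces of [L_S] and for closedness of
    ranges one needs operators of rank one.  Hahn-Banach provides a bounded
    functional [phi] and a vector [z] with [phi z = 1]; then
    [E y := phi(.) y] embeds [X] in [L(X)] as a left [L(X)]-module
    ([left_module_embedding]), and both [R(P)] and [N(P)] are the traces on
    [X] of [R(L_P)] and [N(L_P)].

    From [S] to the multiplications.  When the ascent and the descent of [S]
    are finite, [X] is the sum of [N(S^n)] and [R(S^(n+1))], and an open
    mapping argument modulo the closed subspace [N(S^n)]
    ([open_mapping_mod]) yields a bounded [U] with [S U = U S] and
    [S^n = S^(n+1) U] ([commuting_factor]).  This identity between operators
    can be multiplied on the left and on the right, so it bounds the descents
    of [L_S] and [R_S]; it also makes the powers [S^m], [m >= n], von Neumann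
    regular, and a regular operator has closed range because that range is the
    null space of another bounded operator.

    Conversely, finite ascent and descent of [R_S] give finite descent of [S]
    by pure ring theory ([square_factor_right]).

    Baire's theorem, the source of the open mapping theorem, and Hahn-Banach
    are used over the reals; complex spaces enter through their
    realification. *)

(** * Restriction of scalars from the complex to the real numbers *)

Section Realification.
Local Open Scope complex_scope.
Variable R : realType.

(** A new name for the carrier, so that the real structure does not compete
    with the complex one during inference. *)
Definition realification (X : normedModType R[i]) : Type := X.

Section Normed.
Variable X : normedModType R[i].
Local Notation XR := (realification X).

HB.instance Definition _ := GRing.Zmodule.copy XR X.

Definition realification_scale (a : R) (x : XR) : XR := a%:C *: (x : X).

Fact realification_scaleA a b x :
  realification_scale a (realification_scale b x) =
  realification_scale (a * b) x.
Proof. by rewrite /realification_scale scalerA rmorphM. Qed.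
Fact realification_scale1 : left_id 1 realification_scale.
Proof. by move=> x; rewrite /realification_scale scale1r. Qed.
Fact realification_scaleDr : right_distributive realification_scale +%R.
Proof. by move=> a x y; rewrite /realification_scale scalerDr. Qed.
Fact realification_scaleDl x :
  {morph realification_scale^~ x : a b / a + b}.
Proof. by move=> a b; rewrite /realification_scale rmorphD scalerDl. Qed.

HB.instance Definition _ := GRing.Zmodule_isLmodule.Build R XR
  realification_scaleA realification_scale1 realification_scaleDr
  realification_scaleDl.

Definition realification_norm (x : XR) : R := complex.Re `|x : X|.

Fact realification_normD x y :
  realification_norm (x + y) <= realification_norm x + realification_norm y.
Proof.
by rewrite -lecR rmorphD /= -!normRe; exact: (@ler_normD _ X).
Qed.
Fact realification_normZ a x :
  realification_norm (a *: x) = `|a| * realification_norm x.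
Proof.
apply: (@complexI R); rewrite rmorphM /= -!normRe.
by rewrite [LHS](@normrZ _ X) normc_def /= expr0n addr0 sqrtr_sqr.
Qed.
Fact realification_norm0_eq0 x : realification_norm x = 0 -> x = 0.
Proof.
move=> x0; apply: (@normr0_eq0 _ X).
by rewrite normRe -/(realification_norm x) x0.
Qed.

HB.instance Definition _ := Lmodule_isNormed.Build R XR
  realification_normD realification_normZ realification_norm0_eq0.

End Normed.

Fact realification_complete (X : completeNormedModType R[i])
  (F : set_system (realification X)) : ProperFilter F -> cauchy F -> cvg F.
Proof.
move=> FF /cauchy_ballP Fc.
have Fc' : cauchy (F : set_system X).
  apply/cauchy_ballP => e e0.
  have eE := ge0_ReE (ltW e0).
  have e0' : 0 < complex.Re e by rewrite -ltcR -eE.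
  apply: filterS (Fc _ e0') => -[x y] /=.
  rewrite -!ball_normE /= -ltcR -eE.
  by rewrite -[X in X < _]normRe.
have /cvg_ex[l Fl] := @cauchy_cvg X F FF Fc'.
apply/cvg_ex; exists l; apply/cvgrPdist_lt => e e0.
have e0' : 0 < e%:C by rewrite -[0]/(0%:C) ltcR.
move/cvgrPdist_lt/(_ _ e0') : Fl; apply: filterS => x /=.
by rewrite normRe ltcR.
Qed.

HB.instance Definition _ (X : completeNormedModType R[i]) :=
  Uniform_isComplete.Build (realification X) (@realification_complete X).

End Realification.

(** * The Hahn-Banach theorem *)

Section HahnBanach.
Variables (R : realType) (V : normedModType R).
Implicit Types (A : set (V * R^o)) (x y v : V).

(** Partial functionals are handled as graphs, so that the union of a chain is
    literally a union of sets.  Single-valuedness follows: the difference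
    [(0, r - s)] of two points over the same [x] is dominated by 0, and so is
    its opposite. *)
Definition dominated_graph A :=
  (forall a p q, A p -> A q -> A (a *: p + q)) /\
  (forall p, A p -> p.2 <= `|p.1|).

Lemma dominated_graph_sub A p q : dominated_graph A -> A p -> A q -> A (p - q).
Proof. by move=> [lA _] Ap Aq; rewrite addrC -scaleN1r; exact: lA. Qed.

Lemma dominated_graph_fun A x r s :
  dominated_graph A -> A (x, r) -> A (x, s) -> r = s.
Proof.
move=> dA Ar As; apply/eqP; rewrite eq_le.
have dom := dA.2.
have := dom _ (dominated_graph_sub dA Ar As).
have := dom _ (dominated_graph_sub dA As Ar).
by rewrite /= subrr normr0 !subr_le0 => -> ->.
Qed.

Definition graph_adjoin A v (c : R) : set (V * R^o) :=
  [set p | exists t q, A q /\ p = q + t *: ((v, c) : V * R^o)].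

(** The one-dimensional extension step: the value [c] at [v] must lie above all
    [r - |x - v|] and below all [|y + v| - s], for [(x, r)] and [(y, s)] in the
    graph; the triangle inequality makes these constraints compatible, and
    scaling reduces every other constraint to them. *)
Lemma dominated_graph_adjoin A v : dominated_graph A -> A !=set0 ->
  exists c, dominated_graph (graph_adjoin A v c).
Proof.
move=> dA [p0 Ap0]; have [lA dom] := dA.
have sep p q : A p -> A q -> p.2 - `|p.1 - v| <= `|q.1 + v| - q.2.
  move=> Ap Aq; rewrite lerBlDr addrAC -lerBlDr opprK.
  have := dom _ (lA 1 _ _ Ap Aq); rewrite scale1r /= => /le_trans; apply.
  have -> : p.1 + q.1 = (q.1 + v) + (p.1 - v).
    by rewrite addrACA subrr addr0 addrC.
  exact: ler_normD.
pose E := [set p.2 - `|p.1 - v| | p in A].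
have E0 : E !=set0 by exists (p0.2 - `|p0.1 - v|), p0.
have cub p : A p -> p.2 - `|p.1 - v| <= sup E.
  move=> Ap; apply: ub_le_sup; last by exists p.
  by exists (`|p0.1 + v| - p0.2) => _ [q Aq <-]; exact: sep.
have clb q : A q -> sup E <= `|q.1 + v| - q.2.
  by move=> Aq; apply: ge_sup => // _ [p Ap <-]; exact: sep.
have A0 : A 0 by rewrite -(subrr p0); exact: dominated_graph_sub.
have AZ a p : A p -> A (a *: p) by move=> Ap; rewrite -[a *: p]addr0; exact: lA.
exists (sup E); split.
  move=> a _ _ [t [q [Aq ->]]] [t' [q' [Aq' ->]]].
  exists (a * t + t'), (a *: q + q'); split; first exact: lA.
  by rewrite scalerDr scalerA addrACA -scalerDl.
move=> _ [t [q [Aq ->]]] /=.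
have sE (a b : R) : a *: (b : R^o) = a * b by [].
have [t0|t0|->] := ltgtP t 0; last 1 first.
- by rewrite !scale0r !addr0; exact: dom.
- have := cub _ (AZ (- t)^-1 _ Aq) => /=.
  have nt0 : 0 < - t by rewrite oppr_gt0.
  rewrite -(ler_pM2l nt0) mulrBr -[X in X * `|_|](gtr0_norm nt0) -normrZ.
  rewrite scalerBr scalerA !sE mulrA mulfV ?gt_eqF// mul1r scale1r.
  by rewrite scaleNr opprK lerBlDr mulNr => h; rewrite -lerBrDr addrC.
- have := clb _ (AZ t^-1 _ Aq) => /=.
  rewrite -(ler_pM2l t0) mulrBr -[X in X * `|_|](gtr0_norm t0) -normrZ.
  rewrite scalerDr scalerA !sE mulrA mulfV ?gt_eqF// mul1r scale1r.
  by rewrite lerBrDr addrC.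
Qed.

(** A maximal dominated graph through [(x, |x|)] is defined everywhere, by
    [dominated_graph_adjoin]. *)
Theorem hahn_banach_norming x : exists f : V -> R,
  [/\ forall a y z, f (a *: y + z) = a * f y + f z, f x = `|x| &
      forall y, `|f y| <= `|y|].
Proof.
(* The empty chain has the empty set as union, so only nonempty graphs are
   required to contain (x, |x|). *)
pose P A := dominated_graph A /\ (A !=set0 -> A (x, `|x|)).
have [A [[dA Ax] maxA]] : exists A, P A /\ forall B, A `<` B -> ~ P B.
  apply: Zorn_bigcup => F FP Ftot; split; last first.
    by move=> [p [B FB Bp]]; exists B => //; apply: (FP _ FB).2; exists p.
  split; last by move=> p [B FB]; exact: (FP _ FB).1.2.
  move=> a p q [B FB Bp] [C FC Cq].
  have [BC|CB] := Ftot _ _ FB FC.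
    by exists C => //; apply: (FP _ FC).1.1 => //; exact: BC.
  by exists B => //; apply: (FP _ FB).1.1 => //; exact: CB.
(* The line through (x, |x|) excludes that the maximal set is empty. *)
pose L := [set p | exists t : R, p = t *: ((x, `|x|) : V * R^o)].
have PL : P L.
  split; last by exists 1; rewrite scale1r.
  split.
    by move=> a _ _ [t ->] [s ->]; exists (a * t + s); rewrite scalerDl scalerA.
  by move=> _ [t ->]; rewrite /= normrZ ler_wpM2r// ler_norm.
have A0 : A !=set0.
  apply/set0P/negP => /eqP A0; apply: (maxA L) PL; rewrite A0.
  by split=> // /(_ 0); apply; exists 0; rewrite scale0r.
have {}Ax := Ax A0.
have tot v : exists r, A (v, r).
  have [c dB] := dominated_graph_adjoin v dA A0.
  apply: contrapT => nv.
  have AB : A `<=` graph_adjoin A v c.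
    by move=> p Ap; exists 0, p; rewrite scale0r addr0.
  apply: (maxA (graph_adjoin A v c)); last by split=> // _; exact: AB.
  split=> // BA; apply: nv; exists c; apply: BA; exists 1, 0; split.
    by rewrite -(subrr (x, `|x|)); exact: dominated_graph_sub.
  by rewrite add0r scale1r.
have [f fA] := choice tot.
exists f; split=> [a y z||y].
- by apply: (dominated_graph_fun dA (fA _)); exact: (dA.1 a _ _ (fA y) (fA z)).
- exact: (dominated_graph_fun dA (fA _)).
- rewrite ler_norml lerNl (dA.2 _ (fA y)) andbT.
  have A00 : A (0, 0) by have := dominated_graph_sub dA Ax Ax; rewrite subrr.
  by have := dA.2 _ (dominated_graph_sub dA A00 (fA y)); rewrite /= !sub0r normrN.
Qed.

End HahnBanach.

(** * Closed sets in normed modules *)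

Lemma closed_normP (K : numFieldType) (V : normedModType K) (A : set V) :
  closed A <-> forall p, (forall e : K, 0 < e -> exists2 q, A q & `|p - q| < e) -> A p.
Proof.
split=> [cA p h|h p cp].
  apply: cA => B /nbhs_normP[e e0 eB]; have [q Aq pq] := h _ e0.
  by exists q; split=> //; exact: eB.
apply: h => e e0; have [q [Aq pq]] := cp _ (nbhsx_ballx p e e0).
by exists q => //; rewrite -ball_normE in pq.
Qed.

Lemma closed_preimage_lipschitz (K : numFieldType) (V W : normedModType K)
    (f : V -> W) (M : K) (A : set W) :
  (forall x y, `|f x - f y| <= M * `|x - y|) -> closed A -> closed (f @^-1` A).
Proof.
move=> fM /closed_normP cA; apply/closed_normP => p h; apply: cA => e e0.
have M0 : 0 < `|M| + 1 by rewrite ltr_wpDl.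
have [|q Aq pq] := h (e / (`|M| + 1)); first by rewrite divr_gt0.
exists (f q) => //; rewrite ltr_pdivlMr// in pq; apply: le_lt_trans pq.
have h0 := le_trans (normr_ge0 _) (fM p q).
rewrite -(normr_id (f p - f q)); apply: (le_trans (y := `|M * `|p - q| |)).
  by rewrite normr_id (ger0_norm h0).
by rewrite normrM normr_id mulrC ler_wpM2l// lerDl.
Qed.

Section ClosedRealification.
Local Open Scope complex_scope.
Variable R : realType.

Lemma closed_realification (X : normedModType R[i]) (A : set X) :
  closed A -> closed (A : set (realification X)).
Proof.
move=> /closed_normP cA; apply/closed_normP => p h; apply: cA => e e0.
have eE := ge0_ReE (ltW e0).
have [|q Aq pq] := h (complex.Re e); first by rewrite -ltcR -eE.
by exists q => //; rewrite normRe eE ltcR.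
Qed.

End ClosedRealification.

(** * The open mapping theorem modulo a closed subspace *)

Section OpenMapping.
Variables (R : realType) (V W : completeNormedModType R).
Variables (f : {linear V -> W}) (M : R).
Hypothesis fM : forall x, `|f x| <= M * `|x|.
Variable N : set W.
Hypothesis N0 : N 0.
Hypothesis NB : forall a y z, N y -> N z -> N (a *: y + z).
Hypothesis Ncl : closed N.
Hypothesis fN : forall z, exists x, N (z - f x).

Let subspaceZ a y : N y -> N (a *: y).
Proof. by move=> Ny; rewrite -[_ *: _]addr0; exact: NB. Qed.
Let subspaceD y z : N y -> N z -> N (y + z).
Proof. by move=> Ny Nz; rewrite -[y]scale1r; exact: NB. Qed.
Let subspaceN y : N y -> N (- y).
Proof. by move=> Ny; rewrite -scaleN1r; exact: subspaceZ. Qed.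

Let E (k : nat) := [set z | exists2 x, `|x| <= k%:R & N (z - f x)].

(** The sets [E k] cover [W], so by Baire's theorem the complements of their
    closures cannot all be dense. *)
Let image_ball_somewhere_dense :
  exists k z0 (r : R), 0 < r /\ ball z0 r `<=` closure (E k).
Proof.
apply: contrapT => nE.
have oD k : open (~` closure (E k)) /\ dense (~` closure (E k)).
  split; first exact/closed_openC/closed_closure.
  apply: contrapT => /denseNE [B [] [z [oB Bz]] B0].
  have /nbhs_ballP[r r0 rB] : nbhs z B by exact: open_nbhs_nbhs.
  apply: nE; exists k, z, r; split=> // w /rB Bw; apply: contrapT => nw.
  by rewrite -[False]/(set0 w) -B0.
have := Baire oD.
move=> /(_ setT) [||z [_ zE]]; [by exists 0|exact: openT|].
have [x Nx] := fN z.
apply: (zE (Num.truncn `|x|).+1) => //; apply: subset_closure; exists x => //.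
by apply/ltW; exact: truncnS_gt.
Qed.

(** If [z0] and [z0 + t z] are both nearly attained from a ball of fixed radius,
    then so is their difference [t z]; this moves the dense spot to the origin,
    and rescaling reaches every [z]. *)
Let approximate_preimage : exists C, 0 <= C /\ forall z, exists x w,
  [/\ `|x| <= C * `|z|, `|w| <= 2^-1 * `|z| & N (z - f x - w)].
Proof.
have [k [z0 [r [r0 rE]]]] := image_ball_somewhere_dense.
(* The half keeps z0 + t z, at distance s from z0, inside the open ball. *)
pose s := r / 2; have s0 : 0 < s by rewrite divr_gt0.
have sr : s < r by rewrite ltr_pdivrMr// ltr_pMr// ltr1n.
exists (2 * k%:R / s); split; first by rewrite divr_ge0 ?mulr_ge0// ltW.
move=> z; have [->|z0n] := eqVneq z 0.
  by exists 0, 0; rewrite !normr0 !mulr0 linear0 !subr0.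
pose t := s / `|z|; have t0 : 0 < t by rewrite divr_gt0// normr_gt0.
(* Two errors of norm s / 4, divided by t = s / |z|, add up to |z| / 2. *)
have approx y : ball z0 r y -> exists x w,
    [/\ `|x| <= k%:R, `|w| <= s / 4 & N (y - f x - w)].
  move=> /rE yE; have e0 : 0 < s / 4 by rewrite divr_gt0.
  have [y' [[x xk Nx]]] := yE _ (nbhsx_ballx y _ e0).
  rewrite -ball_normE /= => yy'; exists x, (y - y'); split=> //; first exact: ltW.
  by rewrite opprB addrC addrA subrK.
have [|x1 [w1 [x1k w1s N1]]] := approx z0; first exact: ballxx.
have [|x2 [w2 [x2k w2s N2]]] := approx (z0 + t *: z).
  rewrite -ball_normE /= opprD addNKr normrN normrZ gtr0_norm//.
  by rewrite divfK// normr_eq0.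
exists (t^-1 *: (x2 - x1)), (t^-1 *: (w2 - w1)); split.
- rewrite normrZ gtr0_norm ?invr_gt0// invf_div.
  have := le_trans (ler_normB x2 x1) (lerD x2k x1k).
  rewrite -mulr2n -[k%:R *+ 2]mulr_natl => h.
  by rewrite mulrAC [leRHS]mulrAC ler_pM2r ?invr_gt0// mulrC ler_pM2r ?normr_gt0.
- rewrite normrZ gtr0_norm ?invr_gt0// invf_div mulrAC ler_pdivrMr// mulrC mulrAC.
  rewrite ler_pM2r ?normr_gt0//.
  have := le_trans (ler_normB w2 w1) (lerD w2s w1s).
  lra.
- suff -> : z - f (t^-1 *: (x2 - x1)) - t^-1 *: (w2 - w1) =
    t^-1 *: ((z0 + t *: z - f x2 - w2) - (z0 - f x1 - w1)).
    by apply/subspaceZ/subspaceD => //; exact: subspaceN.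
  rewrite linearZ linearB /= -{1}[z](scalerK (lt0r_neq0 t0)) -!scalerBr.
  congr (_ *: _).
  rewrite !opprB !addrA.
  by rewrite [RHS](ACl (1*7*2*6*3*5*4)) /= subrr add0r.
Qed.

(** With [N] the trivial subspace this is the usual open mapping theorem; in
    general it says that [f] followed by the projection onto the quotient by
    [N] is open, without forming that quotient.  The error left by an
    approximate preimage has at most half the norm of its target, so correcting
    the successive errors [zn n] gives a geometric series of preimages. *)
Theorem open_mapping_mod : exists C, 0 <= C /\ forall z, exists x,
  `|x| <= C * `|z| /\ N (z - f x).
Proof.
have [C [C0 /(_ _)/cid-/all_sig[g /(_ _)/cid-/all_sig[h ghP]]]] := approximate_preimage.
exists (2 * C); split; first by rewrite mulr_ge0.
move=> z.
pose zn n := iter n h z; pose u n := g (zn n).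
have zn_le n : `|zn n| <= 2^-1 ^+ n * `|z|.
  elim: n => [|n ih]; first by rewrite mul1r.
  have [_ h2 _] := ghP (zn n); rewrite (le_trans h2)//.
  by rewrite exprS -mulrA ler_wpM2l// invr_ge0.
have u_le n : `|u n| <= geometric (C * `|z|) 2^-1 n.
  have [h1 _ _] := ghP (zn n); rewrite (le_trans h1)//= -mulrA ler_wpM2l//.
  by rewrite mulrC.
have half : `|2^-1 : R| < 1 by rewrite ger0_norm ?invr_ge0// invf_lt1// ltr1n.
have cnu : cvgn [normed series u].
  apply: (series_le_cvg _ _ u_le) => //=; last exact: is_cvg_geometric_series.
  by move=> n; rewrite !mulr_ge0// exprn_ge0// invr_ge0.
have cu := normed_cvg cnu.
exists (limn (series u)); split.
  apply: le_trans (lim_series_norm cnu) _.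
  apply: le_trans (lim_series_le cnu (is_cvg_geometric_series half) u_le) _.
  rewrite (cvg_lim _ (cvg_geometric_series half))//.
  by rewrite (_ : 1 - 2^-1 = 2^-1 :> R); [rewrite invrK mulrC mulrA|lra].
apply: (proj1 (closed_normP N) Ncl) => e e0.
have Nn n : N (z - f (series u n) - zn n).
  elim: n => [|n ih]; first by rewrite /series /= big_geq// linear0 subr0 subrr.
  have [_ _] := ghP (zn n); rewrite -/(u n) => h3.
  have := subspaceD ih h3; rewrite -[X in _ + X]addrA subrKA.
  by rewrite /series /= big_nat_recr//= linearD opprD !addrA.
have M0 : 0 < `|M| + 1 by rewrite ltr_wpDl.
have zn0 : zn @ \oo --> 0.
  apply/cvgr0Pnorm_lt => d d0.
  have /cvgr0Pnorm_lt/(_ _ d0) := cvg_geometric `|z| half.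
  apply: filterS => n /=; apply: le_lt_trans; rewrite (le_trans (zn_le n))//.
  by rewrite mulrC ler_norm.
have d0 : 0 < e / 2 by rewrite divr_gt0.
have d1 : 0 < e / 2 / (`|M| + 1) by rewrite divr_gt0.
move/cvgrPdist_lt/(_ _ d1) : cu => cu.
move/cvgrPdist_lt/(_ _ d0) : zn0 => zn0.
have [n [/= un znn]] := filter_ex (filterI cu zn0).
exists (z - f (series u n) - zn n) => //.
have -> : z - f (limn (series u)) - (z - f (series u n) - zn n) =
   zn n - f (limn (series u) - series u n).
  by rewrite (linearB f) !opprD !opprK !addrA [LHS](ACl (1*3*5*2*4)) /= subrr add0r.
rewrite (le_lt_trans (ler_normB _ _))//.
rewrite sub0r normrN in znn.
rewrite [ltRHS]splitr ltrD//.
rewrite (le_lt_trans (fM _))//.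
have : M * `|limn (series u) - series u n| <=
    (`|M| + 1) * `|limn (series u) - series u n|.
  by rewrite ler_wpM2r// (le_trans (ler_norm M))// lerDl.
move=> /le_lt_trans; apply.
by rewrite mulrC -ltr_pdivlMr.
Qed.

End OpenMapping.

(** * Embedding a Banach space in its operator algebra *)

Section RankOne.
Local Open Scope complex_scope.
Variable R : realType.

(** A real-linear [f] is the real part of the complex-linear functional
    [f y - i f(i y)]; its value at [x] has real part [|x|], hence is invertible
    and can be normalised to 1. *)
Lemma bounded_functional (X : normedModType R[i]) (x : X) : x != 0 ->
  exists phi : X -> R[i], [/\ forall a y z, phi (a *: y + z) = a * phi y + phi z,
    exists M : R[i], forall y, `|phi y| <= M * `|y| & phi x = 1].
Proof.
move=> x0; have [f [flin fx fle]] := @hahn_banach_norming R (realification X) x.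
pose F (y : X) : R[i] := (f y)%:C - 'i * (f ('i *: y))%:C.
have fD (y z : X) : f (y + z) = f y + f z.
  by have := flin 1 y z; rewrite scale1r mul1r.
have f0 : f 0 = 0 by apply: (addrI (f 0)); rewrite -fD !addr0.
have fZ (a : R) (y : X) : f (a%:C *: y) = a * f y.
  by have := flin a y 0; rewrite f0 !addr0.
have FD y z : F (y + z) = F y + F z.
  by rewrite /F scalerDr !fD !rmorphD /= mulrDr opprD addrACA.
have FZr (a : R) y : F (a%:C *: y) = a%:C * F y.
  by rewrite /F scalerA ['i * a%:C]mulrC -scalerA !fZ !rmorphM /= mulrBr mulrCA.
have FZi y : F ('i *: y) = 'i * F y.
  rewrite /F scalerA -expr2 sqr_i.
  have -> : f (-1 *: y) = - f y.
    by rewrite (_ : -1 = (-1 : R)%:C) ?fZ ?mulN1r// rmorphN1.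
  rewrite mulrBr mulrA -expr2 sqr_i rmorphN /= mulN1r mulrN !opprK addrC //.
have FZ a y : F (a *: y) = a * F y.
  rewrite [a]complexE scalerDl FD -scalerA FZi !FZr mulrDl mulrA //.
have Fx : F x != 0.
  apply/eqP => /(congr1 (@complex.Re R)).
  by rewrite /F fx /= mul0r mulr0 !subr0 => /normr0_eq0 xx; move: x0; rewrite xx eqxx.
exists (fun y => (F x)^-1 * F y); split.
- by move=> a y z; rewrite FD FZ mulrDr mulrCA.
- exists (`|(F x)^-1| * 2) => y; rewrite normrM -mulrA ler_wpM2l//.
  have fn (u : X) : `|(f u)%:C| <= `|u|.
    by rewrite normc_def /= expr0n addr0 sqrtr_sqr normRe lecR; exact: fle.
  have i1 : `|'i : R[i]| = 1 by rewrite normc_def /= expr0n expr1n add0r sqrtr1.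
  rewrite /F (le_trans (ler_normB _ _))// mulr_natl mulr2n lerD// normrM i1.
  by rewrite mul1r (le_trans (fn _))// normrZ i1 mul1r.
- by rewrite mulVf.
Qed.

(** [E y] is the operator of rank one [phi(.) y], with [phi z = 1].  Evaluation
    at [z] is a left inverse of [E], so ranges and null spaces of operators on
    [X] can be read off from their left multiplications.  On the zero space no
    such [phi] exists, but the zero map has the required properties. *)
Lemma left_module_embedding (X : completeNormedModType R[i]) :
  exists (E : X -> blinop X) (z : X) (M : R[i]),
  [/\ forall y, E y z = y, forall S y, S * E y = E (S y) &
      forall y y', `|E y - E y'| <= M * `|y - y'|].
Proof.
have [[z z0]|] := pselect (exists z : X, z != 0); last first.
  move=> /forallNP X0; have {}X0 (y : X) : y = 0.
    by apply/eqP; apply: contrapT => y0; apply: (X0 y); apply/negP.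
  exists (fun=> 0), 0, 0; split=> [y|S y|y y'].
  - by rewrite blinop0E [RHS]X0.
  - by rewrite mulr0.
  - by rewrite subrr normr0 mul0r.
have [phi [philin [M phiM] phiz]] := bounded_functional z0.
have bnd y : (fun x => phi x *: y) \in @is_bounded_op R X.
  apply/is_bounded_opP; split.
    by move=> a u v; rewrite philin scalerDl scalerA.
  by exists (M * `|y|) => u; rewrite normrZ mulrAC ler_wpM2r.
exists (fun y => Blinop (bnd y)), z, M; split=> [y|S y|y y'].
- by rewrite /= phiz scale1r.
- by apply/blinopP => u; rewrite blinopME /= linearZ.
- have M0 : 0 <= M.
    have := phiM z; rewrite phiz normr1 => h.
    by rewrite -(pmulr_lge0 _ (_ : 0 < `|z|)) ?normr_gt0// (le_trans ler01).
  apply: opnorm_le; first by rewrite mulr_ge0.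
  move=> u; rewrite blinopDE blinopNE /= -scalerBr normrZ mulrAC.
  by rewrite ler_wpM2r.
Qed.

End RankOne.

(** * Stabilisation of ranges and null spaces of powers *)

Section Chains.
Local Open Scope complex_scope.
Variables (R : realType) (Y : completeNormedModType R[i]).
Implicit Types S U P W : blinop Y.

Lemma blinop_exprS S n y : (S ^+ n.+1) y = (S ^+ n) (S y).
Proof. by rewrite exprSr. Qed.

Lemma blinop_exprD S m n y : (S ^+ (m + n)) y = (S ^+ m) ((S ^+ n) y).
Proof. by rewrite exprD. Qed.

Lemma range_expr_stableP S n : range (S ^+ n) = range (S ^+ n.+1) <->
  forall x, exists y, (S ^+ n) x = (S ^+ n.+1) y.
Proof.
split=> [e x|h].
  have [y _ yx] : range (S ^+ n.+1) ((S ^+ n) x) by rewrite -e; exists x.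
  by exists y.
apply/seteqP; split=> _ [x _ <-].
  by have [y ->] := h x; exists y.
by exists (S x); rewrite // blinop_exprS.
Qed.

Lemma null_expr_stableP S n :
  null_space (S ^+ n) = null_space (S ^+ n.+1) <->
  forall x, (S ^+ n.+1) x = 0 -> (S ^+ n) x = 0.
Proof.
split=> [e x Sx|h]; first by rewrite -[_ = 0]/(null_space (S ^+ n) x) e.
apply/seteqP; split=> x; rewrite /null_space /=; last exact: h.
by move=> Sx; rewrite exprS blinopME Sx linear0.
Qed.

Lemma range_expr_stable S n m : (n <= m)%N ->
  range (S ^+ n) = range (S ^+ n.+1) -> range (S ^+ m) = range (S ^+ n).
Proof.
move=> /subnK <- /range_expr_stableP h.
elim: (m - n)%N => [//|k ih]; rewrite -{}ih; apply/esym/range_expr_stableP => x.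
have [y xy] := h x; exists y.
by rewrite -addnS !blinop_exprD xy.
Qed.

Lemma range_expr_stable_le S n m : (n <= m)%N ->
  range (S ^+ n) = range (S ^+ n.+1) -> range (S ^+ m) = range (S ^+ m.+1).
Proof.
by move=> nm h; rewrite (range_expr_stable nm h) (range_expr_stable (leqW nm) h).
Qed.

Lemma null_expr_stable S n m x : (n <= m)%N ->
  null_space (S ^+ n) = null_space (S ^+ n.+1) ->
  (S ^+ m) x = 0 -> (S ^+ n) x = 0.
Proof.
move=> /subnK <- /null_expr_stableP h.
elim: (m - n)%N x => [//|k ih] x; rewrite addSn blinop_exprS => /ih.
by rewrite -blinop_exprS; exact: h.
Qed.

Lemma null_expr_stable_le S n m : (n <= m)%N ->
  null_space (S ^+ n) = null_space (S ^+ n.+1) ->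
  null_space (S ^+ m) = null_space (S ^+ m.+1).
Proof.
move=> nm h; apply/null_expr_stableP => x Sx.
rewrite -(subnK nm) blinop_exprD (null_expr_stable _ h Sx) ?linear0//.
exact: leqW.
Qed.

(** This is the inequality of the descent and the ascent when both are finite.
    Far enough, [S^(q+n) x = S^(q+n) (S w)], and [x - S w], killed by
    [S^(q+n)], is already killed by [S^n]. *)
Lemma range_stable_of_null_stable S n q :
  null_space (S ^+ n) = null_space (S ^+ n.+1) ->
  range (S ^+ q) = range (S ^+ q.+1) ->
  range (S ^+ n) = range (S ^+ n.+1).
Proof.
move=> hN hR; apply/range_expr_stableP => x.
have qn : (q <= q + n)%N := leq_addr n q.
have /range_expr_stableP/(_ x)[w xw] := range_expr_stable_le qn hR.
exists w; apply/eqP; rewrite -subr_eq0 blinop_exprS -linearB /=.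
apply/eqP; apply: (null_expr_stable (leq_addl q n) hN).
by rewrite linearB /= -blinop_exprS xw subrr.
Qed.

Lemma blinop_lip U : exists M : R[i], forall x y, `|U x - U y| <= M * `|x - y|.
Proof. by exists `|U| => x y; rewrite -linearB; exact: ler_opnorm. Qed.

Lemma closed_null_space U : closed (null_space U).
Proof.
have [M UM] := blinop_lip U.
apply: (closed_preimage_lipschitz UM (A := [set 0])).
apply/closed_normP => p h; apply/eqP; apply: contraT => p0.
have [|q /= ->] := h `|p|; first by rewrite normr_gt0.
by rewrite subr0 ltxx.
Qed.

(** [P * W] is a projection onto the range of [P], which is therefore the null
    space of [1 - P * W]. *)
Lemma closed_range_regular P W : P = P * W * P -> closed (range P).
Proof.
move=> PWP.
suff -> : range P = null_space (1 - P * W) by exact: closed_null_space.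
apply/seteqP; split=> [_ [x _ <-]|y].
  by rewrite /null_space /= -[LHS]/(((1 - P * W) * P) x) mulrBl mul1r -PWP subrr.
move=> yP; have /eqP : y - P (W y) = 0 := yP.
by rewrite subr_eq0 => /eqP ->; exists (W y).
Qed.

(** Write [z = S^(n+1) x + y] with [S^n y = 0] and put [U z := S^n x].  Two
    choices of [x] differ by an element of [N(S^(2n+1)) = N(S^n)], so [U] is
    well defined, whence its linearity and its commutation with [S].
    Completeness enters for the boundedness of [U]: the open mapping theorem
    modulo [N(S^n)] bounds [x] in terms of [z]. *)
Theorem commuting_factor S n :
  null_space (S ^+ n) = null_space (S ^+ n.+1) ->
  range (S ^+ n) = range (S ^+ n.+1) ->
  exists U, S * U = U * S /\ S ^+ n = S ^+ n.+1 * U.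
Proof.
move=> hN hR.
pose YR := realification Y.
have lf : linear (S ^+ n.+1 : YR -> YR) by move=> a x y; exact: (linearP (S ^+ n.+1)).
pose f : {linear YR -> YR} :=
  HB.pack (S ^+ n.+1 : YR -> YR) (GRing.isLinear.Build _ _ _ _ _ lf).
have [M M0 SM] := blinop_bound (S ^+ n.+1).
have fM (x : YR) : `|f x| <= M * `|x|.
  by rewrite -lecR rmorphM /= -!normRe; exact: SM.
have Ncl := closed_realification (@closed_null_space (S ^+ n)).
have ex z : exists x, (S ^+ n) (z - (S ^+ n.+1) x) = 0.
  have h : range (S ^+ n) = range (S ^+ (n + n.+1)).
    by rewrite -(range_expr_stable (leq_addr n.+1 n) hR).
  have [x _ xz] : range (S ^+ (n + n.+1)) ((S ^+ n) z) by rewrite -h; exists z.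
  by exists x; rewrite linearB /= -xz blinop_exprD subrr.
have [||C [C0 hC]] := open_mapping_mod fM _ _ Ncl ex.
- exact: (linear0 (S ^+ n)).
- move=> a y z y0 z0; have {}y0 : (S ^+ n) (y : Y) = 0 := y0.
  have {}z0 : (S ^+ n) (z : Y) = 0 := z0.
  by have := linearP (S ^+ n) a%:C (y : Y) z; rewrite /= y0 z0 scaler0 addr0.
(* Any admissible x computes U z, whatever the choice made by g. *)
have uniq z x x' : (S ^+ n) (z - (S ^+ n.+1) x) = 0 ->
    (S ^+ n) (z - (S ^+ n.+1) x') = 0 -> (S ^+ n) x = (S ^+ n) x'.
  rewrite !linearB /= -!blinop_exprD => /eqP; rewrite subr_eq0 => /eqP -> /eqP.
  rewrite subr_eq0 => /eqP xx'; apply/eqP; rewrite -subr_eq0 -linearB /=; apply/eqP.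
  by apply: (null_expr_stable (leq_addr n.+1 n) hN); rewrite linearB /= xx' subrr.
have [g gP] := choice hC.
have gN z : (S ^+ n) (z - (S ^+ n.+1) (g z)) = 0 by have [_] := gP z.
have bnd : (fun z => (S ^+ n) (g z)) \in @is_bounded_op R Y.
  apply/is_bounded_opP; split.
    move=> a x y; rewrite -linearP; apply: uniq (gN _) _.
    have -> : a *: x + y - (S ^+ n.+1) (a *: g x + g y) =
      a *: (x - (S ^+ n.+1) (g x)) + (y - (S ^+ n.+1) (g y)).
      by rewrite linearP /= scalerBr opprD addrACA.
    by rewrite linearP /= !gN scaler0 addr0.
  exists (`|S ^+ n| * C%:C) => x; rewrite (le_trans (ler_opnorm (S ^+ n) _))//.
  rewrite -mulrA ler_wpM2l ?opnorm_ge0//.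
  rewrite normRe [X in _ <= _ * X]normRe -rmorphM lecR; exact: (gP x).1.
exists (Blinop bnd); split; apply/blinopP => z; rewrite !blinopME /=.
- rewrite -blinopME -exprS blinop_exprS; apply: (uniq (S z) _ _ _ (gN _)).
  have -> : S z - (S ^+ n.+1) (S (g z)) = S (z - (S ^+ n.+1) (g z)).
    by rewrite linearB /= -blinop_exprS [in LHS]exprS blinopME.
  have cS v : (S ^+ n) (S v) = S ((S ^+ n) v) by rewrite -blinop_exprS exprS.
  by rewrite cS gN linear0.
- rewrite -blinop_exprD addnC blinop_exprD.
  by apply/eqP; rewrite -subr_eq0 -linearB /=; apply/eqP.
Qed.

End Chains.

(** * Finite ascent and descent, Drazin invertibility *)

Section NatInf.
Implicit Type A : set nat.

Lemma nat_infP A n : nat_inf A = Some n <-> A n /\ forall m, A m -> (n <= m)%N.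
Proof.
rewrite /nat_inf; case: pselect => [A0|nA]; last first.
  by split=> // -[An _]; exfalso; apply: nA; exists n; exact: mem_set.
case: ex_minnP => m /set_mem Am mmin; split=> [[<-]|[An nmin]].
  by split=> // k Ak; apply: mmin; exact: mem_set.
by congr Some; apply/eqP; rewrite eqn_leq nmin// mmin//; exact: mem_set.
Qed.

Lemma nat_inf_None A : nat_inf A = None <-> forall n, ~ A n.
Proof.
rewrite /nat_inf; case: pselect => [A0|nA]; split=> //.
  by move=> nA; have [n /set_mem An] := A0; have := nA n An.
by move=> _ n An; apply: nA; exists n; exact: mem_set.
Qed.

Lemma nat_inf_ex A n : A n -> exists m, nat_inf A = Some m.
Proof.
move=> An; case E : (nat_inf A) => [m|]; first by exists m.
by have /nat_inf_None/(_ n) := E.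
Qed.
End NatInf.

Section Drazin.
Variables (R : realType) (Y : completeNormedModType R[i]).
Implicit Types S : blinop Y.

Definition finite_descent S := exists n, range (S ^+ n) = range (S ^+ n.+1).
Definition finite_ascent S :=
  exists n, null_space (S ^+ n) = null_space (S ^+ n.+1).

Lemma descent_NoneP S : descent S = None <-> ~ finite_descent S.
Proof.
by rewrite /descent nat_inf_None; split=> [h [n /h]|h n hn] //; apply: h; exists n.
Qed.

Lemma ascent_NoneP S : ascent S = None <-> ~ finite_ascent S.
Proof.
by rewrite /ascent nat_inf_None; split=> [h [n /h]|h n hn] //; apply: h; exists n.
Qed.

Lemma right_drazinP S : right_drazin_invertible S <->
  exists2 n, range (S ^+ n) = range (S ^+ n.+1) & closed (range (S ^+ n)).
Proof.
split=> [[n /nat_infP[hn _] cn]|[n hn cn]]; first by exists n.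
have [m Sm] := nat_inf_ex (A := [set n | range (S ^+ n) = range (S ^+ n.+1)]) hn.
exists m => //; have /nat_infP[hm /(_ _ hn) mn] := Sm.
by rewrite -(range_expr_stable mn hm).
Qed.

Lemma right_drazin_finite_descent S :
  right_drazin_invertible S -> finite_descent S.
Proof. by move=> /right_drazinP[n hn _]; exists n. Qed.

Lemma left_drazin_finite_ascent S : left_drazin_invertible S -> finite_ascent S.
Proof. by move=> [n /nat_infP[hn _] _]; exists n. Qed.

End Drazin.

(** * Left and right multiplications *)

(** Cancelling [b * b] on the right in [(b w - 1) b^2 = 0] gives [b w b = b], and
    doing the same in [(w - b w w) b^2 = 0] gives [w b = b w w b]; substitute the
    second in the first. *)
Lemma square_factor_right (A : pzRingType) (b w : A) :
  b = w * (b * b) -> (forall u, u * (b * b) = 0 -> u * b = 0) ->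
  b = b * b * (w * w * b).
Proof.
move=> bw reg.
have bwb : b * w * b = b.
  apply/eqP; rewrite -subr_eq0 -{3}[b]mul1r -mulrBl; apply/eqP/reg.
  by rewrite mulrBl mul1r -[b * w * _]mulrA -bw subrr.
have : (w - b * w * w) * b = 0.
  apply: reg; rewrite mulrBl -[_ * w * (b * b)]mulrA -bw bwb.
  by rewrite subrr.
rewrite mulrBl => /eqP; rewrite subr_eq0 => /eqP wb.
by rewrite -{1}bwb -[b * w * b]mulrA {1}wb !mulrA.
Qed.

Section Multiplications.
Variables (R : realType) (X : completeNormedModType R[i]).
Implicit Types S T U P W : blinop X.

Lemma lmulopX S n : lmulop S ^+ n = lmulop (S ^+ n).
Proof.
elim: n => [|n ih]; first by apply/blinopP => U; rewrite /= mul1r.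
by rewrite exprS ih; apply/blinopP => U; rewrite blinopME /= exprS mulrA.
Qed.

Lemma rmulopX S n : rmulop S ^+ n = rmulop (S ^+ n).
Proof.
elim: n => [|n ih]; first by apply/blinopP => U; rewrite /= mulr1.
by rewrite exprS ih; apply/blinopP => U; rewrite blinopME /= exprSr mulrA.
Qed.

Lemma lmulopB_scalar T (l : R[i]) :
  lmulop T - l *: (1 : blinop (blinop X)) = lmulop (T - l *: (1 : blinop X)).
Proof. by apply/blinopP => U; apply/blinopP. Qed.

Lemma rmulopB_scalar T (l : R[i]) :
  rmulop T - l *: (1 : blinop (blinop X)) = rmulop (T - l *: (1 : blinop X)).
Proof.
apply/blinopP => U; apply/blinopP => x.
have e : U (T x - l *: x) = U (T x) - l *: U x by rewrite linearB linearZ.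
exact: esym e.
Qed.

(** If [S^(n+1) x = 0] then [L_(S^(n+1))] kills the rank-one operator [E x], so
    null spaces on [L(X)] detect those on [X]. *)
Lemma ascent_lmulop S : ascent (lmulop S) = ascent S.
Proof.
congr nat_inf; apply/seteqP; split=> n /= /null_expr_stableP h;
  apply/null_expr_stableP; last first.
  move=> U; rewrite !lmulopX /= => /blinopP SU; apply/blinopP => x.
  by rewrite blinopME blinop0E; apply: h; rewrite -blinopME SU.
have [E [z [M [Ez SE _]]]] := left_module_embedding X.
move=> x Sx; have E0 : E 0 = 0 by rewrite -(mul0r (E 0)) SE.
have := h (E x); rewrite !lmulopX /= !SE Sx => /(_ E0).
move=> /(congr1 (fun V : blinop X => V z)).
by rewrite Ez.
Qed.

Lemma range_lmulop_stable S n :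
  range (lmulop S ^+ n) = range (lmulop S ^+ n.+1) ->
  range (S ^+ n) = range (S ^+ n.+1).
Proof.
move=> /range_expr_stableP/(_ 1)[U]; rewrite !lmulopX /= mulr1 => SU.
by apply/range_expr_stableP => x; exists (U x); rewrite SU.
Qed.

(** [R(P)] is the preimage of [R(L_P)] under the Lipschitz map [E]: if
    [E y = P V], evaluating at [z] gives [y = P (V z)]. *)
Lemma closed_range_of_lmulop P : closed (range (lmulop P)) -> closed (range P).
Proof.
have [E [z [M [Ez SE EM]]]] := left_module_embedding X.
move=> cP; suff -> : range P = E @^-1` range (lmulop P).
  exact: closed_preimage_lipschitz EM cP.
apply/seteqP; split=> [_ [x _ <-]|y [V _ /= PV]].
  by exists (E x); rewrite //= SE.
by exists (V z); rewrite // -blinopME PV Ez.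
Qed.

Lemma finite_descent_lmulop S : finite_descent (lmulop S) -> finite_descent S.
Proof. by move=> [n /range_lmulop_stable]; exists n. Qed.

Lemma right_drazin_lmulop S :
  right_drazin_invertible (lmulop S) -> right_drazin_invertible S.
Proof.
move=> /right_drazinP[n hn]; rewrite lmulopX => /closed_range_of_lmulop cn.
by apply/right_drazinP; exists n => //; exact: range_lmulop_stable.
Qed.

Lemma left_drazin_lmulop S :
  left_drazin_invertible (lmulop S) -> left_drazin_invertible S.
Proof.
move=> [n]; rewrite ascent_lmulop lmulopX => aS cn.
by exists n => //; exact: closed_range_of_lmulop.
Qed.

Lemma finite_descent_rmulop_ascent S :
  finite_descent (rmulop S) -> finite_ascent S.
Proof.
move=> [n /range_expr_stableP/(_ 1)[U]]; rewrite !rmulopX /= mul1r => SU.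
by exists n; apply/null_expr_stableP => x Sx; rewrite SU blinopME Sx linear0.
Qed.

Lemma finite_descent_ascent_rmulop S :
  finite_descent S -> finite_ascent (rmulop S).
Proof.
move=> [n /range_expr_stableP h]; exists n; apply/null_expr_stableP => U.
rewrite !rmulopX /= => /blinopP US; apply/blinopP => x.
by rewrite blinopME; have [y ->] := h x; exact: US.
Qed.

(** The exponent of the factorisation can be any exponent at which the null
    spaces have stabilised, in particular the ascent. *)
Lemma finite_ascent_descent_factor S n :
  null_space (S ^+ n) = null_space (S ^+ n.+1) -> finite_descent S ->
  exists U, S * U = U * S /\ S ^+ n = S ^+ n.+1 * U.
Proof.
move=> hN [q hR]; apply: commuting_factor => //.
exact: range_stable_of_null_stable hR.
Qed.

Lemma finite_descent_rmulop_of_ascent S :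
  finite_ascent S -> finite_descent S -> finite_descent (rmulop S).
Proof.
move=> [n hn] /(finite_ascent_descent_factor hn)[U [cU SU]].
exists n; apply/range_expr_stableP => V; exists (V * U).
have cUS : GRing.comm U (S ^+ n.+1) by apply: commrX; rewrite /GRing.comm cU.
by rewrite !rmulopX /= SU -cUS mulrA.
Qed.

(** [S * U] acts as the identity on the right of [S ^+ m], hence so does
    [(S * U) ^+ m = U ^+ m * S ^+ m]. *)
Lemma regular_power S n m U : S * U = U * S -> S ^+ n = S ^+ n.+1 * U ->
  (n <= m)%N -> S ^+ m = S ^+ m * U ^+ m * S ^+ m.
Proof.
move=> cU SU nm.
have {}SU : S ^+ m = S ^+ m * (S * U).
  by rewrite mulrA -exprSr -(subnK nm) -addnS !exprD -mulrA -SU.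
have cSU k : S ^+ m = S ^+ m * (U ^+ k * S ^+ k).
  elim: k => [|k ih]; first by rewrite !expr0 !mulr1.
  rewrite exprSr exprS -mulrA [U * _]mulrA -cU.
  have c : GRing.comm (U ^+ k) (S * U).
    by apply/commr_sym/commrX; rewrite /GRing.comm mulrA -cU.
  by rewrite [U ^+ k * _]mulrA c -!mulrA [S * (U * _)]mulrA mulrA -SU.
by rewrite -mulrA -cSU.
Qed.

Lemma closed_range_lmulop_regular S m W : S ^+ m = S ^+ m * W * S ^+ m ->
  closed (range (lmulop S ^+ m)).
Proof.
move=> h; apply: (@closed_range_regular _ _ _ (lmulop W)).
by rewrite lmulopX; apply/blinopP => V; rewrite /= [in LHS]h !mulrA.
Qed.

(** The exponent must be the ascent itself: left Drazin invertibility is a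
    condition on the range of the power that follows it. *)
Lemma drazin_lmulop S : finite_ascent S -> finite_descent S ->
  right_drazin_invertible (lmulop S) /\ left_drazin_invertible (lmulop S).
Proof.
move=> [k hk] fd.
pose A := [set n | null_space (S ^+ n) = null_space (S ^+ n.+1)].
have [n Sn] := nat_inf_ex (A := A) hk.
have /nat_infP[hn _] := Sn.
have [U [cU SU]] := finite_ascent_descent_factor hn fd.
split; last first.
  exists n; first by rewrite ascent_lmulop.
  exact: closed_range_lmulop_regular (regular_power cU SU (leqnSn n)).
apply/right_drazinP; exists n.
  apply/range_expr_stableP => V; exists (U * V).
  by rewrite !lmulopX /= mulrA -SU.
exact: closed_range_lmulop_regular (regular_power cU SU (leqnn n)).
Qed.

Lemma finite_descent_lmulop_of_ascent S :
  finite_ascent S -> finite_descent S -> finite_descent (lmulop S).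
Proof.
by move=> fa fd; exact: right_drazin_finite_descent (drazin_lmulop fa fd).1.
Qed.

(** Apply [square_factor_right] to [b := S^m] in [L(X)]: finite descent of [R_S]
    gives [S^m = W S^(2m)], and finite ascent of [R_S] says that [S^(2m)] can be
    cancelled down to [S^m] on the right.  The resulting [S^m = S^(2m) Z] is
    stabilisation of the ranges of the powers of [S]. *)
Lemma finite_descent_of_rmulop S :
  finite_ascent (rmulop S) -> finite_descent (rmulop S) -> finite_descent S.
Proof.
move=> [n hN] [q hR]; have {q}hR := range_stable_of_null_stable hN hR.
(* m is positive, so that the range of S^(2m) lies in that of S^(m+1). *)
have n1 := leqnSn n; set m := n.+1.
have m2 : (n <= m + m)%N by rewrite (leq_trans n1)// leq_addr.
have [W _ SW] : range (rmulop S ^+ (m + m)) (S ^+ m).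
  rewrite (range_expr_stable m2 hR) -(range_expr_stable n1 hR) rmulopX.
  by exists 1; rewrite //= mul1r.
rewrite rmulopX /= in SW.
have h : S ^+ m = S ^+ m * S ^+ m * (W * W * S ^+ m).
  apply: square_factor_right; first by rewrite -exprD.
  move=> u; rewrite -exprD => u0.
  have : (rmulop S ^+ n) u = 0 by apply: (null_expr_stable m2 hN); rewrite rmulopX.
  by rewrite rmulopX /= /m => un; rewrite exprSr mulrA un mul0r.
exists m; apply/range_expr_stableP => x; exists ((S ^+ n) ((W * W * S ^+ m) x)).
by rewrite {1}h -exprD blinopME -blinop_exprD addSn addnS.
Qed.

End Multiplications.

Theorem theorem8 (R : realType) (X : completeNormedModType R[i])
    (T : blinop X) :
  (sigma_desc T `<=` sigma_desc (lmulop T) /\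
   sigma_asc T = sigma_asc (lmulop T)) /\
  (sigma_RD T `<=` sigma_RD (lmulop T) /\
   sigma_LD T `<=` sigma_LD (lmulop T)) /\
  (sigma_asc T `<=` sigma_desc (rmulop T) /\
   sigma_asc (rmulop T) `<=` sigma_desc T) /\
  (sigma_desc (lmulop T) `\` sigma_desc T `<=` sigma_asc T /\
   sigma_desc (lmulop T) `&` rho_asc T = sigma_desc T `&` rho_asc T) /\
  (sigma_RD (lmulop T) `\` sigma_RD T `<=` sigma_LD T /\
   sigma_RD (lmulop T) `&` rho_LD T = sigma_RD T `&` rho_LD T) /\
  (sigma_LD (lmulop T) `\` sigma_LD T `<=` sigma_RD T /\
   sigma_LD (lmulop T) `&` rho_RD T = sigma_LD T `&` rho_RD T) /\
  (sigma_desc (rmulop T) `\` sigma_asc T `<=` sigma_desc T /\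
   sigma_desc (rmulop T) `&` rho_desc T = sigma_asc T `&` rho_desc T) /\
  (sigma_desc T `\` sigma_asc (rmulop T) `<=` sigma_desc (rmulop T) /\
   sigma_desc T `&` rho_desc (rmulop T) =
     sigma_asc (rmulop T) `&` rho_desc (rmulop T)).
Proof.
pose S (l : R[i]) : blinop X := T - l *: (1 : blinop X).
have descT l : sigma_desc T l <-> ~ finite_descent (S l) := descent_NoneP _.
have ascT l : sigma_asc T l <-> ~ finite_ascent (S l) := ascent_NoneP _.
have descL l : sigma_desc (lmulop T) l <-> ~ finite_descent (lmulop (S l)).
  by rewrite -lmulopB_scalar; exact: descent_NoneP.
have descR l : sigma_desc (rmulop T) l <-> ~ finite_descent (rmulop (S l)).
  by rewrite -rmulopB_scalar; exact: descent_NoneP.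
have ascR l : sigma_asc (rmulop T) l <-> ~ finite_ascent (rmulop (S l)).
  by rewrite -rmulopB_scalar; exact: ascent_NoneP.
have LDL l : sigma_LD (lmulop T) l <-> ~ left_drazin_invertible (lmulop (S l)).
  by rewrite -lmulopB_scalar.
have RDL l : sigma_RD (lmulop T) l <-> ~ right_drazin_invertible (lmulop (S l)).
  by rewrite -lmulopB_scalar.
(* The equality of A and B off C follows from the inclusion of A `\` B in C
   once B lies in A, so each pair of claims below has a single content. *)
have subI (A B C : set R[i]) : B `<=` A -> A `\` B `<=` C ->
    A `\` B `<=` C /\ A `&` ~` C = B `&` ~` C.
  move=> BA AC; split=> //; apply/seteqP; split=> l [Al Cl]; split=> //.
    by apply: contrapT => Bl; apply/Cl/AC.
  exact: BA.
have i1 : sigma_desc T `<=` sigma_desc (lmulop T).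
  by move=> l /descT h; apply/descL; apply: contra_not h; exact: finite_descent_lmulop.
have ii1 : sigma_RD T `<=` sigma_RD (lmulop T).
  by move=> l h; apply/RDL; apply: contra_not h; exact: right_drazin_lmulop.
have ii2 : sigma_LD T `<=` sigma_LD (lmulop T).
  by move=> l h; apply/LDL; apply: contra_not h; exact: left_drazin_lmulop.
have iii1 : sigma_asc T `<=` sigma_desc (rmulop T).
  move=> l /ascT h; apply/descR; apply: contra_not h.
  exact: finite_descent_rmulop_ascent.
have iii2 : sigma_asc (rmulop T) `<=` sigma_desc T.
  move=> l /ascR h; apply/descT; apply: contra_not h.
  exact: finite_descent_ascent_rmulop.
split; first split=> //.
  apply/seteqP; split=> l; rewrite /sigma_asc /=;
  by rewrite lmulopB_scalar ascent_lmulop.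
split=> //; split=> //; split; last split; last split; last split.
- apply: subI => // l [/descL h /descT/contrapT fd]; apply/ascT => fa.
  exact/h/finite_descent_lmulop_of_ascent.
- apply: subI => // l [/RDL h /contrapT rd] ld; apply: h.
  exact: (drazin_lmulop (left_drazin_finite_ascent ld)
           (right_drazin_finite_descent rd)).1.
- apply: subI => // l [/LDL h /contrapT ld] rd; apply: h.
  exact: (drazin_lmulop (left_drazin_finite_ascent ld)
           (right_drazin_finite_descent rd)).2.
- apply: subI => // l [/descR h /ascT/contrapT fa]; apply/descT => fd.
  exact/h/finite_descent_rmulop_of_ascent.
- apply: subI => // l [/descT h /ascR/contrapT fa]; apply/descR => fd.
  exact/h/finite_descent_of_rmulop.
Qed.
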